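(* Let $(\Omega,\mathcal{F},\mathbb{P})$ be a probability space with a discrete-time filtration $(\mathcal{F}_n)_{n\ge0}$. Suppose $X=(X_n)_{n\ge0}$ is a discrete time near-submartingale and $\tau$ is a stopping time with respect to $(\mathcal{F}_n)$. Then the stopped process $X^\tau$ defined by $X^\tau_n=X_{\tau\wedge n}$ is a discrete time near-submartingale.
   Context: A discrete time near-submartingale with respect to $(\mathcal{F}_n)_{n\ge0}$ is a process $(X_n)_{n\ge0}$ of integrable random variables such that for all $m\le n$, $\mathbb{E}(X_n-X_m\mid\mathcal{F}_m)\ge0$ almost surely (adaptedness of $X$ is not part of the definition). *)

(* Defs.v *)
From HB Require Import structures.
From mathcomp Require Import all_boot all_order all_algebra.
From mathcomp Require Import all_classical all_reals all_analysis.

Set Implicit Arguments.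
Unset Strict Implicit.
Unset Printing Implicit Defensive.

Import Order.TTheory GRing.Theory Num.Theory.
Import numFieldNormedType.Exports.

Local Open Scope classical_set_scope.
Local Open Scope ring_scope.

(* Sub-sigma-algebras of the ambient one are represented by their families of
   sets, so that one carrier can be equipped with a whole filtration. *)
Definition filtration (d : measure_display) (T : measurableType d)
    (F : nat -> set (set T)) : Prop :=
  [/\ forall n, sigma_algebra setT (F n),
      forall n, F n `<=` measurable &
      forall m n, (m <= n)%N -> F m `<=` F n].

(* [Y] is a version of E(Z | G). The type [g_sigma_algebraType G] is [T]
   carrying the sigma-algebra <<s G >>, which is [G] when [G] is already a
   sigma-algebra. *)
Definition is_cond_expectation (d : measure_display) (T : measurableType d)
    (R : realType) (P : probability T R) (G : set (set T)) (Z Y : T -> R)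
    : Prop :=
  [/\ measurable_fun [set: g_sigma_algebraType G] Y,
      P.-integrable setT (EFin \o Y) &
      forall A, G A ->
        (\int[P]_(x in A) (Y x)%:E = \int[P]_(x in A) (Z x)%:E)%E].

(* Versions of a conditional expectation agree almost surely, so the sign
   condition on E(X_n - X_m | F_m) does not depend on the version [Y]. *)
Definition near_submartingale (d : measure_display) (T : measurableType d)
    (R : realType) (P : probability T R) (F : nat -> set (set T))
    (X : nat -> T -> R) : Prop :=
  (forall n, P.-integrable setT (EFin \o X n)) /\
  (forall m n, (m <= n)%N ->
    exists2 Y : T -> R,
      is_cond_expectation P (F m) (fun w => X n w - X m w) Y &
      {ae P, forall w, 0 <= Y w}).

(* Random times take values in {0, 1, 2, ...} with infinity added: [None]
   stands for infinity. *)
Definition stopping_time (d : measure_display) (T : measurableType d)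
    (F : nat -> set (set T)) (tau : T -> option nat) : Prop :=
  forall n, F n [set w | if tau w is Some k then (k <= n)%N else false].

Definition time_min (t : option nat) (n : nat) : nat :=
  if t is Some k then minn k n else n.

Definition stopped_process (T : Type) (R : Type) (X : nat -> T -> R)
    (tau : T -> option nat) : nat -> T -> R :=
  fun n w => X (time_min (tau w) n) w.

(* Main.v *)
Require Import Defs.
From HB Require Import structures.
From mathcomp Require Import all_boot all_order all_algebra.
From mathcomp Require Import all_classical all_reals all_analysis.
From mathcomp Require Import measurable_realfun.

(** The stopped process is a sum of increments of [X] that are switched off
    after [tau]: for m <= n,
      X^tau_n - X^tau_m = \sum_(m <= k < n) 1_{tau > k} (X_(k+1) - X_k)
    ([stopped_process_increment]). The event {tau > k} is known at time k
    ([not_stopped_past]), so for A in F_m the integral of the k-th term over A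
    is the integral of X_(k+1) - X_k over A /\ {tau > k}, a set of F_k, and is
    nonnegative because X is a near-submartingale.

    This argument speaks of integrals over sets of the past, whereas a
    near-submartingale is defined by the sign of a version of a conditional
    expectation. [near_submartingaleP] translates one into the other. It rests
    on two facts about a sub-sigma-algebra G: every integrable variable has a
    version of its conditional expectation ([cond_expectation_exists], by
    Radon-Nikodym), and such a version is almost surely nonnegative exactly
    when the variable has nonnegative integral over each set of G
    ([cond_expectation_ge0P]). *)

Set Implicit Arguments.
Unset Strict Implicit.
Unset Printing Implicit Defensive.

Import Order.TTheory GRing.Theory Num.Theory.
Import numFieldNormedType.Exports.

Local Open Scope classical_set_scope.
Local Open Scope ring_scope.

Section conditional_expectation.
Context (d : measure_display) (T : measurableType d) (R : realType).
Variables (P : probability T R) (G : set (set T)).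
Hypotheses (salgG : sigma_algebra setT G) (measG : G `<=` measurable).

Let G_measurableE (A : set T) :
  (measurable : set (set (g_sigma_algebraType G))) A = G A.
Proof. by rewrite measurable_g_measurableTypeE. Qed.

Let idG : T -> g_sigma_algebraType G := id.

Let measurable_idG : measurable_fun setT idG.
Proof.
move=> _ A; rewrite G_measurableE setTI => GA.
exact: measG.
Qed.

Let idG_mixin := isMeasurableFun.Build _ _ _ _ _ measurable_idG.
Let idG_mfun : {mfun T >-> g_sigma_algebraType G} := HB.pack idG idG_mixin.

Let PG : probability (g_sigma_algebraType G) R := distribution P idG_mfun.

(** The signed measure A |-> \int_A Z on G is dominated by the trace of P on G,
    and its Radon-Nikodym derivative there is a version of E(Z | G). The
    signed measure and the trace are obtained as images under the identity map
    from T to T equipped with G, so that integrals of G-measurable functions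
    transfer back to P by change of variables. *)
Lemma cond_expectation_exists (Z : T -> R) :
  P.-integrable setT (EFin \o Z) -> exists Y, is_cond_expectation P G Z Y.
Proof.
move=> intZ.
(* An image is a charge only for a measurable map; that proof cannot be
   inferred, so [image_charge] comes out as a function of it. *)
pose image_charge : {charge set (g_sigma_algebraType G) -> \bar R} :=
  pushforward (induced_charge intZ) idG.
pose nu := image_charge measurable_idG.
have nuP : nu `<< PG.
  apply/null_content_dominatesP => A; rewrite G_measurableE => GA PA.
  apply: null_set_integral => //; first exact: measG.
  exact: measurable_funTS (measurable_int _ intZ).
pose f := Radon_Nikodym nu PG.
(* The derivative is finite everywhere, so it loses nothing as a real function. *)
have fE : EFin \o (fine \o f) = f.
  by apply/funext => x /=; rewrite fineK// Radon_Nikodym_fin_num.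
have intf := Radon_Nikodym_integrable nuP.
have mf := measurable_int _ intf.
have intPf : P.-integrable setT (f \o idG).
  apply/integrableP; split; first exact: measurableT_comp mf _.
  have /integrableP[_] := intf.
  by rewrite ge0_integral_pushforward//; exact: measurableT_comp.
exists (fine \o f); split.
- by apply/measurable_EFinP; rewrite fE; exact: mf.
- by rewrite fE.
- move=> A GA.
  have mGA : measurable (A : set (g_sigma_algebraType G)).
    by rewrite G_measurableE.
  transitivity (nu A) => //.
  rewrite (Radon_Nikodym_integral nuP mGA) (integral_pushforward measurable_idG)//.
    by apply: eq_integral => x _; exact: (congr1 (@^~ x) fE).
  by apply: integrableS intPf => //; exact: measG.
Qed.

(** Y and Z have the same integral over each set of G. For the converse direction, the set
    {Y < 0} itself belongs to G; the integral of Y over it is both nonpositive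
    and nonnegative, hence zero, which forces the set to be negligible. *)
Lemma cond_expectation_ge0P (Z Y : T -> R) :
  is_cond_expectation P G Z Y ->
  {ae P, forall w, 0 <= Y w} <->
  (forall A, G A -> (0 <= \int[P]_(x in A) (Z x)%:E)%E).
Proof.
move=> [mY intY intYZ].
have mYT : measurable_fun [set: T] (EFin \o Y) := measurable_int _ intY.
split => [Y0 A GA|Z0].
  have mA := measG GA.
  rewrite -intYZ// (ae_eq_integral (abse \o (EFin \o Y)))//.
  - by apply: integral_ge0 => x _; exact: abse_ge0.
  - exact: measurable_funTS.
  - by apply: measurable_funTS; exact: measurableT_comp.
  - by apply: filterS Y0 => x Yx _; rewrite /= ger0_norm.
pose N := [set w | Y w < 0].
have GN : G N.
  have -> : N = Y @^-1` `]-oo, 0[ by apply/funext => w; rewrite /N /= in_itv.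
  rewrite -G_measurableE -[X in measurable X]setTI.
  by apply: mY => //; exact: measurable_itv.
have mN := measG GN.
have YN : (\int[P]_(x in N) `|(Y x)%:E| = 0)%E.
  apply/eqP; rewrite eq_le integral_ge0// andbT.
  rewrite (eq_integral (fun x => - (Y x)%:E))%E; last first.
    by move=> x /set_mem Nx; rewrite lte0_abs// lte_fin.
  rewrite integralN; last first.
    by apply: integrable_add_def => //; exact: integrableS intY.
  by rewrite oppe_le0 intYZ// Z0.
have /(ae_eq_integral_abs P mN) : measurable_fun N (EFin \o Y).
  exact: measurable_funTS.
move=> [/(_ YN) + _]; apply: filterS => w Yw0.
by rewrite leNgt; apply/negP => Yw; have [Y0] := Yw0 Yw; rewrite Y0 ltxx in Yw.
Qed.

End conditional_expectation.

Section near_submartingale_theory.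
Context (d : measure_display) (T : measurableType d) (R : realType).
Variables (P : probability T R) (F : nat -> set (set T)).
Hypothesis filtF : filtration F.

(** The form in which the property is stable under stopping: integrals over
    sets of the past add up along increments and localize to subsets, with no
    version of a conditional expectation to choose. *)
Lemma near_submartingaleP (X : nat -> T -> R) :
  near_submartingale P F X <->
  (forall n, P.-integrable setT (EFin \o X n)) /\
  (forall m n A, (m <= n)%N -> F m A ->
    (0 <= \int[P]_(x in A) (X n x - X m x)%:E)%E).
Proof.
have [salgF measF _] := filtF.
split=> -[intX subX]; split=> //.
  move=> m n A mn FA; have [Y condY Y0] := subX _ _ mn.
  by apply: (cond_expectation_ge0P (salgF m) (measF m) condY).1.
move=> m n mn.
have intD : P.-integrable setT (EFin \o (fun w => X n w - X m w)).
  exact: integrableB (intX n) (intX m).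
have [Y condY] := cond_expectation_exists (salgF m) (measF m) intD.
exists Y => //; apply/(cond_expectation_ge0P (salgF m) (measF m) condY) => A FA.
exact: subX.
Qed.

Definition not_stopped (tau : T -> option nat) (k : nat) : set T :=
  [set w | if tau w is Some j then (k < j)%N else true].

(** {tau > k} is the complement of {tau <= k}; this is where it matters that
    stopping at time k is decided by the information at time k. *)
Lemma not_stopped_past (tau : T -> option nat) (k : nat) :
  stopping_time F tau -> F k (not_stopped tau k).
Proof.
move=> stau; have [salgF _ _] := filtF.
rewrite -(sigma_algebra_id (salgF k)).
have -> : not_stopped tau k =
    ~` [set w | if tau w is Some j then (j <= k)%N else false].
  apply/seteqP; rewrite /not_stopped; split=> w /=; case: (tau w) => // j.
    by rewrite ltnNge => /negP.
  by rewrite ltnNge => /negP.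
apply: sigma_algebraC; rewrite (sigma_algebra_id (salgF k)); exact: stau.
Qed.

(** From time k to k + 1 the stopped process moves as X does while tau > k and
    stands still afterwards; the sum telescopes. *)
Lemma stopped_process_increment (X : nat -> T -> R) (tau : T -> option nat)
    (m n : nat) (w : T) : (m <= n)%N ->
  ((stopped_process X tau n w - stopped_process X tau m w)%:E =
   \sum_(m <= k < n)
     ((fun x => (X k.+1 x - X k x)%:E) \_ (not_stopped tau k)) w)%E.
Proof.
move=> mn.
rewrite -(telescope_sumr (fun k => stopped_process X tau k w) mn) -sumEFin.
apply: eq_bigr => k _; rewrite patchE /stopped_process.
case: ifPn => [/set_mem|/negP]; rewrite /not_stopped /= /time_min.
  case: (tau w) => // j kj.
  by rewrite (minn_idPr kj) (minn_idPr (ltnW kj)).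
rewrite inE /=; case: (tau w) => [j /negP|//].
rewrite -leqNgt => jk; rewrite (minn_idPl jk) (minn_idPl (leqW jk)).
by rewrite subrr.
Qed.

End near_submartingale_theory.

Theorem theorem3p6 (d : measure_display) (T : measurableType d) (R : realType)
    (P : probability T R) (F : nat -> set (set T)) (X : nat -> T -> R)
    (tau : T -> option nat)
    (hF : filtration F)
    (hX : near_submartingale P F X)
    (htau : stopping_time F tau) :
  near_submartingale P F (stopped_process X tau).
Proof.
have [salgF measF monoF] := hF.
have /(near_submartingaleP P hF)[intX subX] := hX.
have mD k : measurable (not_stopped tau k).
  by apply: (measF k); exact: not_stopped_past.
have intD k : P.-integrable setT
    ((fun x => (X k.+1 x - X k x)%:E) \_ (not_stopped tau k)).
  apply/(integrable_mkcond _ (mD k)).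
  apply: (@integrableS _ _ _ _ setT) => //.
  exact: integrableB (intX k.+1) (intX k).
apply/(near_submartingaleP P hF); split=> [n|m n A mn FA].
  (* The process starts at X_0 whatever tau is, so X^tau_n is X_0 plus finitely
     many integrable terms. *)
  have -> : EFin \o stopped_process X tau n = (EFin \o X 0) \+ (fun w =>
      \sum_(0 <= k < n)
        ((fun x => (X k.+1 x - X k x)%:E) \_ (not_stopped tau k)) w)%E.
    apply/funext => w /=; rewrite -stopped_process_increment//.
    have -> : stopped_process X tau 0 w = X 0 w.
      by rewrite /stopped_process /time_min; case: (tau w) => // j; rewrite minn0.
    by rewrite -EFinD addrC subrK.
  by apply: integrableD => //; exact: integrable_sum.
have mA := measF _ _ FA.
under eq_integral do rewrite stopped_process_increment//.
rewrite integral_sum//; last first.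
  by move=> k; exact: integrableS (intD k).
rewrite big_nat_cond sume_ge0// => k /andP[/andP[mk _] _].
(* Integrating the k-th term over A is integrating over A /\ {tau > k}, which
   lies in F k since A lies in F m and m <= k. *)
rewrite -integral_mkcondr; apply: subX => //.
rewrite -(measurable_g_measurableTypeE (salgF k)).
by apply: measurableI; rewrite measurable_g_measurableTypeE//;
  [exact: monoF mk _ FA|exact: not_stopped_past].
Qed.
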